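(* Assume that $\tilde{\mathcal S}$ is a concave projection, where the difference determinant $\delta_1$ is of different sign than $\delta_2,\delta_3,\delta_4$. If $$\det(\tilde X_1\ \tilde X_2)\det(\tilde X_2\ \tilde X_3)<0\quad\text{and}\quad\det(\tilde X_3\ \tilde X_4)\det(\tilde X_4\ \tilde X_1)>0,$$ or $$\det(\tilde X_2\ \tilde X_3)\det(\tilde X_3\ \tilde X_4)>0\quad\text{and}\quad\det(\tilde X_4\ \tilde X_1)\det(\tilde X_1\ \tilde X_2)>0,$$ then a unique sliding vector field is defined on the codimension-2 discontinuity $\Lambda$ (at $(x,0,0)$) of the piecewise smooth system $(X_1,X_2,X_3,X_4)$.
   Context: Setting. Let $\mathcal U\subset\mathbb R^3$ with coordinates $(x,y,z)$, $\mathcal I$ an interval, $\Lambda=\{(x,0,0):x\in\mathcal I\}$, $\mathcal Q_1=\{y\ge0,z\ge0\}$, $\mathcal Q_2=\{y\le0,z\ge0\}$, $\mathcal Q_3=\{y\le0,z\le0\}$, $\mathcal Q_4=\{y\ge0,z\le0\}$. The piecewise smooth system is $(\dot x,\dot y,\dot z)^T=X_i$ on $\mathcal Q_i$ with smooth $X_i=(\alpha_i,\beta_i,\gamma_i)^T$; standing assumption: $\alpha_i,\beta_i,\gamma_i$ depend only on $x$. Fix $x\in\mathcal I$ and let $\tilde X_i=(\beta_i,\gamma_i)^T\in\mathbb R^2$ be evaluated at $x$. $\det(a\ b)$ is the determinant of the matrix with columns $a,b$. For $(\psi,\phi)\in(-1,1)^2$ let $$\tilde F_x(\psi,\phi)=\tfrac12\Big(\tfrac{\tilde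 X_1}{2}(1+\phi)+\tfrac{\tilde X_4}{2}(1-\phi)\Big)(1+\psi)+\tfrac12\Big(\tfrac{\tilde X_2}{2}(1+\phi)+\tfrac{\tilde X_3}{2}(1-\phi)\Big)(1-\psi),$$ and $\tilde{\mathcal S}=\tilde F_x((-1,1)^2)$. Sliding. Sliding vector fields at $(x,0,0)$ correspond to zeros $(\psi_*,\phi_* )\in(-1,1)^2$ of $\tilde F_x$: with $\sigma_\psi=(1+\psi_* )/2$, $\sigma_\phi=(1+\phi_* )/2$, the sliding vector field has $x$-component $\sigma_\psi\sigma_\phi\alpha_1+(1-\sigma_\psi)\sigma_\phi\alpha_2+(1-\sigma_\psi)(1-\sigma_\phi)\alpha_3+\sigma_\psi(1-\sigma_\phi)\alpha_4$ and vanishing $y,z$-components. ''Unique'' means exactly one such zero. Projection type. With indices mod 4, let $\chi_i=\tilde X_{i+1}-\tilde X_i$ and let the difference determinants be $\delta_i=\det(\chi_i\ \chi_{i+1})$, $i=1,2,3,4$. $\tilde{\mathcal S}$ is a concave projection if three of $\delta_1,\dots,\delta_4$ are of the same sign and the remaining one is of opposite sign. *)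

(* Defs.v *)
From HB Require Import structures.
From mathcomp Require Import all_boot all_order all_algebra.
From mathcomp Require Import all_classical all_reals all_analysis.
Set Implicit Arguments.
Unset Strict Implicit.
Unset Printing Implicit Defensive.
Import Order.TTheory GRing.Theory Num.Theory.
Import numFieldNormedType.Exports.
Local Open Scope classical_set_scope.
Local Open Scope ring_scope.

(** Points and vectors of R^3 are row vectors ['rV[R]_3], with coordinates
    [p 0 0], [p 0 1], [p 0 2] for x, y, z.  The four quadrants and the four
    vector fields are indexed by ['Z_4], so that the index arithmetic is modulo
    4; the numerals 1, 2, 3, 4 keep their usual meaning, with 4 = 0. *)

Definition vec3 (R : realType) (a b c : R) : 'rV[R]_3 :=
  \row_(j < 3) nth 0 [:: a; b; c] j.

Definition quadrant (R : realType) (i : 'Z_4) : set 'rV[R]_3 :=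
  match val i with
  | 1%N => [set p | 0 <= p 0 1 /\ 0 <= p 0 2]
  | 2%N => [set p | p 0 1 <= 0 /\ 0 <= p 0 2]
  | 3%N => [set p | p 0 1 <= 0 /\ p 0 2 <= 0]
  | _ => [set p | 0 <= p 0 1 /\ p 0 2 <= 0]
  end.

Definition Lambda (R : realType) (I : interval R) : set 'rV[R]_3 :=
  [set vec3 x 0 0 | x in [set` I]].

Definition iter_partial (R : realType) (s : seq 'I_3)
    (f : 'rV[R]_3 -> 'rV[R]_3) : 'rV[R]_3 -> 'rV[R]_3 :=
  foldr (fun j g p => 'D_(delta_mx 0 j) g p) f s.

(** C^infinity on an arbitrary set A (e.g. relative to a closed quadrant):
    restriction to A of a function all of whose iterated partial derivatives
    exist and are continuous on an open set containing A. *)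
Definition smooth_on (R : realType) (A : set 'rV[R]_3)
    (f : 'rV[R]_3 -> 'rV[R]_3) : Prop :=
  exists (O : set 'rV[R]_3) (g : 'rV[R]_3 -> 'rV[R]_3),
    [/\ open O, A `<=` O, (forall p, A p -> f p = g p) &
        forall (s : seq 'I_3) (p : 'rV[R]_3), O p ->
          {for p, continuous (iter_partial s g)} /\
          forall j : 'I_3, derivable (iter_partial s g) p (delta_mx 0 j)].

Definition depends_only_on_x (R : realType) (A : set 'rV[R]_3)
    (f : 'rV[R]_3 -> 'rV[R]_3) : Prop :=
  forall p q, A p -> A q -> p 0 0 = q 0 0 -> f p = f q.

Section AtPoint.
Variables (R : realType) (X : 'Z_4 -> 'rV[R]_3 -> 'rV[R]_3) (x : R).

Definition alpha (i : 'Z_4) : R := X i (vec3 x 0 0) 0 0.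
Definition beta (i : 'Z_4) : R := X i (vec3 x 0 0) 0 1.
Definition gamma (i : 'Z_4) : R := X i (vec3 x 0 0) 0 2.

Definition Xtilde (i : 'Z_4) : 'cV[R]_2 :=
  \col_(j < 2) nth 0 [:: beta i; gamma i] j.

Definition Ftilde (psi phi : R) : 'cV[R]_2 :=
  2^-1 *: ((1 + psi) *: ((1 + phi) *: (2^-1 *: Xtilde 1) +
                         (1 - phi) *: (2^-1 *: Xtilde 4))) +
  2^-1 *: ((1 - psi) *: ((1 + phi) *: (2^-1 *: Xtilde 2) +
                         (1 - phi) *: (2^-1 *: Xtilde 3))).

Definition sliding_zero (psi phi : R) : Prop :=
  [/\ -1 < psi < 1, -1 < phi < 1 & Ftilde psi phi = 0].

Definition sliding_vector (psi phi : R) : 'rV[R]_3 :=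
  let spsi := (1 + psi) / 2 in
  let sphi := (1 + phi) / 2 in
  vec3 (spsi * sphi * alpha 1 + (1 - spsi) * sphi * alpha 2 +
        (1 - spsi) * (1 - sphi) * alpha 3 + spsi * (1 - sphi) * alpha 4) 0 0.

(** Sliding vector fields are counted by the zeros they come from: two distinct
    zeros count as two sliding vector fields even if the vectors coincide. *)
Definition unique_sliding_vector_field : Prop :=
  exists! s : (R * R) * 'rV[R]_3,
    sliding_zero s.1.1 s.1.2 /\ s.2 = sliding_vector s.1.1 s.1.2.

Definition det2 (a b : 'cV[R]_2) : R := \det (row_mx a b : 'M[R]_2).

Definition chi (i : 'Z_4) : 'cV[R]_2 := Xtilde (i + 1) - Xtilde i.

Definition delta (i : 'Z_4) : R := det2 (chi i) (chi (i + 1)).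

Definition concave_projection : Prop :=
  exists i : 'Z_4, delta i != 0 /\
    forall j : 'Z_4, j != i -> Num.sg (delta j) = - Num.sg (delta i).

End AtPoint.

(* Main.v *)
(** Write [s = (1 + psi) / 2], [t = (1 + phi) / 2].  A zero means that the
    origin divides the segment from [A s] (on the edge 12) to [B s] (on the
    edge 43) in the ratio given by [t].  Hence [s] is a root of the quadratic
    [det (A s, B s)], which takes the values [det (X2, X3)] and [- det (X4, X1)]
    at [s = 0] and [s = 1]; if these have opposite signs there is exactly one
    root in (0, 1).  At that root [A s] and [B s] point in opposite directions
    as soon as a linear form separates the edges 12 and 43 (here a
    determinant with [X1] or [X3]), and then [t] exists and is unique.
    The vertex 2 of the dart is the reflex one, so [X2] is a barycentre of
    [X1], [X3], [X4] with positive weights; this forces the signs needed, up to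
    reversing the orientation and exchanging the vertices 1 and 3. *)

Require Import Defs.
From HB Require Import structures.
From mathcomp Require Import all_boot all_order all_algebra.
From mathcomp Require Import all_classical all_reals all_analysis.
From mathcomp Require Import ring lra.
Set Implicit Arguments.
Unset Strict Implicit.
Unset Printing Implicit Defensive.
Import Order.TTheory GRing.Theory Num.Theory.
Import numFieldNormedType.Exports.
Local Open Scope classical_set_scope.
Local Open Scope ring_scope.

(** * Zeros of a bilinear interpolation of four points of the plane *)

Definition cross (R : pzRingType) (u v : R * R) : R := u.1 * v.2 - u.2 * v.1.

Definition bilinear_interp (R : pzRingType) (a1 a2 a3 a4 s t : R) : R :=
  s * t * a1 + (1 - s) * t * a2 + (1 - s) * (1 - t) * a3 + s * (1 - t) * a4.

Definition interior_zero (R : numDomainType) (p1 p2 p3 p4 : R * R)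
    (z : R * R) : Prop :=
  [/\ 0 < z.1 < 1, 0 < z.2 < 1,
      bilinear_interp p1.1 p2.1 p3.1 p4.1 z.1 z.2 = 0 &
      bilinear_interp p1.2 p2.2 p3.2 p4.2 z.1 z.2 = 0].

(** Eliminating [m] between the two equations leaves [s' - s] times a factor that the signs of [c]
    and [e] make positive. *)
Lemma bernstein_root_unique (R : realDomainType) (c m e s s' : R) :
  0 < c -> e < 0 -> 0 < s < 1 -> 0 < s' < 1 ->
  c * (1 - s) ^+ 2 + m * (s * (1 - s)) + e * s ^+ 2 = 0 ->
  c * (1 - s') ^+ 2 + m * (s' * (1 - s')) + e * s' ^+ 2 = 0 -> s = s'.
Proof.
move=> c0 e0 /andP[s0 s1] /andP[t0 t1] qs qt.
have pos : 0 < c * ((1 - s) * (1 - s')) + (- e) * (s * s').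
  by rewrite addr_gt0 ?mulr_gt0 ?subr_gt0 ?oppr_gt0.
have : (s' - s) * (c * ((1 - s) * (1 - s')) + (- e) * (s * s')) = 0.
  transitivity (s' * (1 - s') *
      (c * (1 - s) ^+ 2 + m * (s * (1 - s)) + e * s ^+ 2) -
    s * (1 - s) *
      (c * (1 - s') ^+ 2 + m * (s' * (1 - s')) + e * s' ^+ 2)); first by ring.
  by rewrite qs qt !mulr0 subrr.
by move/eqP; rewrite mulf_eq0 (gt_eqF pos) orbF subr_eq0 => /eqP.
Qed.

Lemma bernstein_root_exists (R : rcfType) (c m e : R) :
  0 < c -> e < 0 ->
  exists2 s, 0 < s < 1 &
    c * (1 - s) ^+ 2 + m * (s * (1 - s)) + e * s ^+ 2 = 0.
Proof.
move=> c0 e0.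
pose p : {poly R} :=
  (* The sign is reversed because [poly_ivt] expects a nonpositive value at the left end and a
     nonnegative one at the right. *)
  - (c *: (1 - 'X) ^+ 2 + m *: ('X * (1 - 'X)) + e *: 'X ^+ 2).
have pE s : p.[s] = - (c * (1 - s) ^+ 2 + m * (s * (1 - s)) + e * s ^+ 2).
  by rewrite /p !hornerE.
have [s /andP[s0 s1] /rootP] : exists2 s, 0 <= s <= 1 & root p s.
  apply: poly_ivt => //; rewrite !pE; apply/andP; split; nra.
rewrite pE => /eqP; rewrite oppr_eq0 => /eqP qs.
exists s => //; rewrite !lt_neqAle s0 s1 !andbT eq_sym.
by apply/andP; split; apply/eqP => sE; move: qs; rewrite sE; nra.
Qed.

(** The weight [t] makes the form [cross w] vanish on the combination of [a] and [b]. That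
    combination is also parallel to [a], which is independent of [w], so it is zero. *)
Lemma opposite_collinear (R : realFieldType) (w a b : R * R) :
  cross a b = 0 -> cross w a < 0 -> 0 < cross w b ->
  exists2 t, 0 < t < 1 &
    t * a.1 + (1 - t) * b.1 = 0 /\ t * a.2 + (1 - t) * b.2 = 0.
Proof.
move=> ab0 wa wb.
have D0 : 0 < cross w b - cross w a by rewrite subr_gt0 (lt_trans wa).
have Dn0 := gt_eqF D0; have wan0 : cross w a != 0 by rewrite lt_eqF.
exists (cross w b / (cross w b - cross w a)).
  by rewrite divr_gt0 //= ltr_pdivrMr // mul1r ltrDl oppr_gt0.
set t := _ / _.
have tE : t * cross w a + (1 - t) * cross w b = 0.
  by rewrite /t; field; rewrite Dn0.
(* Cramer: [cross w a *: v = cross w v *: a + cross v a *: w] *)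
split; apply: (mulfI wan0); rewrite mulr0.
- transitivity ((t * cross w a + (1 - t) * cross w b) * a.1 -
    (1 - t) * cross a b * w.1); first by rewrite /cross; ring.
  by rewrite tE ab0 mulr0 !mul0r subrr.
- transitivity ((t * cross w a + (1 - t) * cross w b) * a.2 -
    (1 - t) * cross a b * w.2); first by rewrite /cross; ring.
  by rewrite tE ab0 mulr0 !mul0r subrr.
Qed.

Lemma unique_interior_zero (R : rcfType) (p1 p2 p3 p4 : R * R) :
  0 < cross p2 p3 -> 0 < cross p3 p4 -> 0 < cross p4 p1 ->
  0 < cross p1 p2 \/ 0 <= cross p1 p3 ->
  exists! z, interior_zero p1 p2 p3 p4 z.
Proof.
move=> d23 d34 d41 d.
pose A s : R * R :=
  (s * p1.1 + (1 - s) * p2.1, s * p1.2 + (1 - s) * p2.2).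
pose B s : R * R :=
  (s * p4.1 + (1 - s) * p3.1, s * p4.2 + (1 - s) * p3.2).
have interpE1 s t : bilinear_interp p1.1 p2.1 p3.1 p4.1 s t =
    t * (A s).1 + (1 - t) * (B s).1.
  by rewrite /bilinear_interp /=; ring.
have interpE2 s t : bilinear_interp p1.2 p2.2 p3.2 p4.2 s t =
    t * (A s).2 + (1 - t) * (B s).2.
  by rewrite /bilinear_interp /=; ring.
have [w wsep] : exists w : R * R, forall s, 0 < s < 1 ->
    cross w (A s) < 0 /\ 0 < cross w (B s).
  (* The sign of [cross p1 p3] decides which vertex gives the separating form: [p3] if it is
     nonnegative, [- p1] otherwise. *)
  have [d13|d13] := leP 0 (cross p1 p3).
    exists p3 => s /andP[s0 s1].
    have -> : cross p3 (A s) = - (s * cross p1 p3 + (1 - s) * cross p2 p3).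
      by rewrite /cross /=; ring.
    have -> : cross p3 (B s) = s * cross p3 p4 by rewrite /cross /=; ring.
    by split; nra.
  have d12 : 0 < cross p1 p2 by case: d => //; rewrite leNgt d13.
  exists (- p1.1, - p1.2) => s /andP[s0 s1].
  have -> : cross (- p1.1, - p1.2) (A s) = - ((1 - s) * cross p1 p2).
    by rewrite /cross /=; ring.
  have -> : cross (- p1.1, - p1.2) (B s) =
      s * cross p4 p1 - (1 - s) * cross p1 p3 by rewrite /cross /=; ring.
  by split; nra.
pose m := cross p1 p3 + cross p2 p4.
have crossAB s : cross (A s) (B s) = cross p2 p3 * (1 - s) ^+ 2 +
    m * (s * (1 - s)) + (- cross p4 p1) * s ^+ 2.
  by rewrite /m /cross /=; ring.
have d41N : - cross p4 p1 < 0 by rewrite oppr_lt0.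
have [s s01 qs] := bernstein_root_exists m d23 d41N.
have [wA wB] := wsep s s01.
have [t t01 [z1 z2]] := opposite_collinear (etrans (crossAB s) qs) wA wB.
exists (s, t); split; first by split; rewrite ?interpE1 ?interpE2.
case=> s' t' [/= s'01 t'01]; rewrite interpE1 interpE2 => y1 y2.
have /andP[t'0 t'1] := t'01; have /andP[t0 t1] := t01.
(* Taking the cross product of the vanishing combination with [B s'] leaves
   [t' * cross (A s') (B s') = 0], so [s'] is a root of the same quadratic. *)
have es : s = s'.
  apply: (bernstein_root_unique d23 d41N s01 s'01 qs); rewrite -crossAB.
  apply: (mulfI (lt0r_neq0 t'0)); rewrite mulr0.
  transitivity ((t' * (A s').1 + (1 - t') * (B s').1) * (B s').2 -
    (t' * (A s').2 + (1 - t') * (B s').2) * (B s').1).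
    by rewrite /cross; ring.
  by rewrite y1 y2 !mul0r subrr.
rewrite -{}es in y1 y2 *; congr pair.
(* Once [s] is shared, [cross w] is applied to the difference of the two combinations; separation
   makes the second factor negative. *)
have : (t - t') * (cross w (A s) - cross w (B s)) = 0.
  transitivity (w.1 * ((t * (A s).2 + (1 - t) * (B s).2) -
                       (t' * (A s).2 + (1 - t') * (B s).2)) -
                w.2 * ((t * (A s).1 + (1 - t) * (B s).1) -
                       (t' * (A s).1 + (1 - t') * (B s).1))).
    by rewrite /cross; ring.
  by rewrite y1 y2 z1 z2 !subrr !mulr0 subrr.
move/eqP; rewrite mulf_eq0 [X in _ || X]lt_eqF ?orbF.
  by rewrite subr_eq0 => /eqP.
by rewrite subr_lt0 (lt_trans wA).
Qed.

(** * Darts: orientations, symmetries and signs of the cross products *)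

Definition orient (R : pzRingType) (p q r : R * R) : R :=
  (q.1 - p.1) * (r.2 - q.2) - (q.2 - p.2) * (r.1 - q.1).

Lemma exists_unique_transfer (T T' : Type) (P : T -> Prop) (Q : T' -> Prop)
    (f : T -> T') (g : T' -> T) :
  cancel g f -> (forall x, P x -> Q (f x)) -> (forall y, Q y -> P (g y)) ->
  (exists! x, P x) -> exists! y, Q y.
Proof.
move=> gK PQ QP [x [Px Ux]]; exists (f x); split; first exact: PQ.
by move=> y Qy; rewrite (Ux (g y)) ?gK //; exact: QP.
Qed.

Definition reflect_pt (R : pzRingType) (p : R * R) : R * R := (p.1, - p.2).

Lemma cross_reflect (R : comPzRingType) (p q : R * R) :
  cross (reflect_pt p) (reflect_pt q) = - cross p q.
Proof. by rewrite /cross /=; ring. Qed.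

Lemma orient_reflect (R : comPzRingType) (p q r : R * R) :
  orient (reflect_pt p) (reflect_pt q) (reflect_pt r) = - orient p q r.
Proof. by rewrite /orient /=; ring. Qed.

Lemma interior_zero_reflect (R : realDomainType) (p1 p2 p3 p4 z : R * R) :
  interior_zero (reflect_pt p1) (reflect_pt p2) (reflect_pt p3) (reflect_pt p4)
    z <-> interior_zero p1 p2 p3 p4 z.
Proof.
rewrite /interior_zero /=.
have -> : bilinear_interp (- p1.2) (- p2.2) (- p3.2) (- p4.2) z.1 z.2 =
    - bilinear_interp p1.2 p2.2 p3.2 p4.2 z.1 z.2.
  by rewrite /bilinear_interp; ring.
split=> -[h1 h2 h3 h4]; split=> //; last by rewrite h4 oppr0.
by rewrite -[LHS]opprK h4 oppr0.
Qed.

(** The substitution [(s, t) -> (1 - t, 1 - s)] exchanges the weights of vertices 1 and 3 and fixes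
    those of 2 and 4. *)
Lemma interior_zero_swap (R : realDomainType) (p1 p2 p3 p4 z : R * R) :
  interior_zero p3 p2 p1 p4 z -> interior_zero p1 p2 p3 p4 (1 - z.2, 1 - z.1).
Proof.
case=> /andP[h1 h1'] /andP[h2 h2'] h3 h4; split => /=.
- by rewrite subr_gt0 h2' ltrBlDr ltrDl.
- by rewrite subr_gt0 h1' ltrBlDr ltrDl.
- by rewrite -h3 /bilinear_interp; ring.
- by rewrite -h4 /bilinear_interp; ring.
Qed.

(* [a, b, c, d, x] are the cross products 12, 23, 34, 41, 13, and [D i] is the
   orientation of the triangle [i, i+1, i+2]; the last two equations express
   that the reflex vertex 2 is a barycentre of 1, 3, 4. *)
Lemma dart_signs (R : realDomainType) (D1 D2 D3 D4 a b c d x : R) :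
  D1 < 0 -> 0 < D2 -> 0 < D3 -> 0 < D4 ->
  0 < a + b + c + d -> D3 = c + d + x ->
  D3 * a = D4 * x + D1 * d -> D3 * b = D2 * x + D1 * c ->
  (a * b < 0 /\ 0 < c * d) \/ (0 < b * c /\ 0 < d * a) ->
  [/\ 0 < c, 0 < d & 0 < b /\ (0 < a \/ 0 <= x) \/ 0 < a /\ (0 < b \/ 0 <= x)].
Proof.
move=> D1n D2p D3p D4p Sp D3E aE bE hd.
(* Since [D1] is negative, the barycentre equations carry signs from [x] to [a] and [b], and
   back. *)
have apos : 0 <= x -> d < 0 -> 0 < a.
  move=> x0 d0; rewrite -(pmulr_rgt0 _ D3p) aE.
  by rewrite ltr_wpDl ?mulr_ge0 ?nmulr_rgt0 // ltW.
have bpos : 0 <= x -> c < 0 -> 0 < b.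
  move=> x0 c0; rewrite -(pmulr_rgt0 _ D3p) bE.
  by rewrite ltr_wpDl ?mulr_ge0 ?nmulr_rgt0 // ltW.
have xpos_a : 0 < a -> 0 < d -> 0 < x.
  move=> a0 d0; rewrite -(pmulr_rgt0 _ D4p).
  have -> : D4 * x = D3 * a - D1 * d by rewrite aE addrK.
  by rewrite addr_gt0 ?mulr_gt0 // -mulNr mulr_gt0 ?oppr_gt0.
have xpos_b : 0 < b -> 0 < c -> 0 < x.
  move=> b0 c0; rewrite -(pmulr_rgt0 _ D2p).
  have -> : D2 * x = D3 * b - D1 * c by rewrite bE addrK.
  by rewrite addr_gt0 ?mulr_gt0 // -mulNr mulr_gt0 ?oppr_gt0.
have same_sign (u v : R) : 0 < u * v -> u < 0 /\ v < 0 \/ 0 < u /\ 0 < v.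
  case: (ltrgt0P u) => [u0|u0|->]; last by rewrite mul0r ltxx.
    by rewrite pmulr_rgt0 //; right.
  by rewrite nmulr_rgt0 //; left.
case: hd => [[ab /same_sign [[c0 d0]|[c0 d0]]]|[]].
(* With [c] and [d] negative, [D3 = c + d + x] forces [x] to be positive, hence [a] and [b] too,
   against [a * b < 0]. *)
- have x0 : 0 <= x by lra.
  by move: ab; rewrite ltNge mulr_ge0 // ltW // ?apos ?bpos.
- have x0 (ab0 : 0 < a \/ 0 < b) : 0 <= x.
    by apply: ltW; case: ab0 => ?; [apply: xpos_a|apply: xpos_b].
  split=> //; case: (ltrgt0P a) ab => [a0|a0|->]; last by rewrite mul0r ltxx.
    by move=> _; right; split=> //; right; apply: x0; left.
  by rewrite nmulr_rlt0 // => b0; left; split=> //; right; apply: x0; right.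
(* All four negative contradicts the positive sum, and the two mixed patterns contradict the
   barycentre equations; only all positive survives. *)
- move=> /same_sign [[b0 c0]|[b0 c0]] /same_sign [[d0 a0]|[d0 a0]].
  + by exfalso; lra.
  + by have := bpos (ltW (xpos_a a0 d0)) c0; rewrite ltNge ltW.
  + by have := apos (ltW (xpos_b b0 c0)) d0; rewrite ltNge ltW.
  + by split=> //; left; split=> //; left.
Qed.

Lemma unique_interior_zero_dart (R : rcfType) (p1 p2 p3 p4 : R * R) :
  orient p1 p2 p3 < 0 ->
  0 < orient p2 p3 p4 -> 0 < orient p3 p4 p1 -> 0 < orient p4 p1 p2 ->
  (cross p1 p2 * cross p2 p3 < 0 /\ 0 < cross p3 p4 * cross p4 p1) \/
  (0 < cross p2 p3 * cross p3 p4 /\ 0 < cross p4 p1 * cross p1 p2) ->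
  exists! z, interior_zero p1 p2 p3 p4 z.
Proof.
move=> D1 D2 D3 D4 hd.
(* Shoelace formula: twice the signed area of the dart, cut along the diagonal 24 into two
   positively oriented triangles. *)
have Sp : 0 < cross p1 p2 + cross p2 p3 + cross p3 p4 + cross p4 p1.
  have -> : cross p1 p2 + cross p2 p3 + cross p3 p4 + cross p4 p1 =
      orient p2 p3 p4 + orient p4 p1 p2 by rewrite /orient /cross; ring.
  exact: addr_gt0.
have [] := @dart_signs _ _ _ _ _ _ _ _ _ (cross p1 p3) D1 D2 D3 D4 Sp _ _ _ hd.
- by rewrite /orient /cross; ring.
- by rewrite /orient /cross; ring.
- by rewrite /orient /cross; ring.
move=> d34 d41 [[d23 d]|[d12 d]]; first exact: unique_interior_zero.
(* Here [cross p1 p2] must take the place of [cross p2 p3]. Exchanging vertices 1 and 3 does this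
   but reverses the orientation, which the reflection restores. *)
pose r := @reflect_pt R.
apply: (@exists_unique_transfer _ _
  (interior_zero (r p3) (r p2) (r p1) (r p4)) _
  (fun z => (1 - z.2, 1 - z.1)) (fun z => (1 - z.2, 1 - z.1))).
- by case=> u v /=; rewrite !subKr.
- by move=> z /interior_zero_reflect /interior_zero_swap.
- by move=> z /interior_zero_swap h; apply/interior_zero_reflect.
have crossrr p q : cross (r p) (r q) = cross q p by rewrite /cross /=; ring.
by apply: unique_interior_zero; rewrite !crossrr //.
Qed.

(** * From matrices and vector fields to points of the plane *)

Definition Xpoint (R : realType) (X : 'Z_4 -> 'rV[R]_3 -> 'rV[R]_3) (x : R)
  (i : 'Z_4) : R * R := (beta X x i, gamma X x i).

Lemma det2_cross (R : realType) (a b : 'cV[R]_2) :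
  det2 a b = cross (a 0 0, a 1 0) (b 0 0, b 1 0).
Proof.
have L i : (row_mx a b : 'M[R]_2) i 0 = a i 0.
  by rewrite -(row_mxEl a b i 0); congr (row_mx a b i _); apply: val_inj.
have M i : (row_mx a b : 'M[R]_2) i 1 = b i 0.
  by rewrite -(row_mxEr a b i 0); congr (row_mx a b i _); apply: val_inj.
have e1 : lift 0 0 = 1 :> 'I_2 by apply: val_inj.
have e0 : lift 1 0 = 0 :> 'I_2 by apply: val_inj.
rewrite /det2 (expand_det_row _ 0) !big_ord_recl big_ord0 addr0.
rewrite /cofactor !det_mx11 /row' /col' !(mxE matrix_key).
rewrite !e1 !e0 !L !M /cross /= add0n expr0 expr1; ring.
Qed.

Lemma det2_Xtilde (R : realType) (X : 'Z_4 -> 'rV[R]_3 -> 'rV[R]_3) (x : R)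
    (i j : 'Z_4) :
  det2 (Xtilde X x i) (Xtilde X x j) = cross (Xpoint X x i) (Xpoint X x j).
Proof. by rewrite det2_cross !mxE. Qed.

Lemma delta_orient (R : realType) (X : 'Z_4 -> 'rV[R]_3 -> 'rV[R]_3) (x : R)
    (i : 'Z_4) :
  delta X x i =
  orient (Xpoint X x i) (Xpoint X x (i + 1)) (Xpoint X x (i + 1 + 1)).
Proof. by rewrite /delta /chi det2_cross !mxE. Qed.

Lemma sliding_zeroP (R : realType) (X : 'Z_4 -> 'rV[R]_3 -> 'rV[R]_3)
    (x psi phi : R) :
  sliding_zero X x psi phi <->
  interior_zero (Xpoint X x 1) (Xpoint X x 2) (Xpoint X x 3) (Xpoint X x 4)
    ((1 + psi) / 2, (1 + phi) / 2).
Proof.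
have F0 j : Ftilde X x psi phi j 0 = bilinear_interp
    (Xtilde X x 1 j 0) (Xtilde X x 2 j 0) (Xtilde X x 3 j 0) (Xtilde X x 4 j 0)
    ((1 + psi) / 2) ((1 + phi) / 2).
  by rewrite /bilinear_interp !mxE; field.
have itv (r : R) : (-1 < r < 1) = (0 < (1 + r) / 2 < 1).
  by apply/andP/andP => -[? ?]; split; lra.
have F1 := F0 0; have F2 := F0 1; rewrite ![Xtilde _ _ _ _ _]mxE /= in F1 F2.
split.
  case; rewrite !itv => h1 h2 h3; split=> //=.
    by rewrite -F1 h3 mxE.
  by rewrite -F2 h3 mxE.
case; rewrite -!itv /= -F1 -F2 => h1 h2 h3 h4; split=> //.
apply/matrixP => j k; rewrite (ord1 k) [RHS]mxE.
case: (j =P 0) => [->//|/eqP j0]; suff -> : j = 1 by [].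
by move: j j0 => [[|[|//]] //= lj] _; apply: val_inj.
Qed.

Theorem proposition6 (R : realType) (U : set 'rV[R]_3) (I : interval R)
    (X : 'Z_4 -> 'rV[R]_3 -> 'rV[R]_3)
    (hLambda : Lambda I `<=` U)
    (hsmooth : forall i : 'Z_4, smooth_on (U `&` quadrant i) (X i))
    (hx_only : forall i : 'Z_4, depends_only_on_x (U `&` quadrant i) (X i))
    (x : R) (hx : x \in I)
    (hconcave : concave_projection X x)
    (hdelta1 : forall j : 'Z_4, j != 1 ->
       Num.sg (delta X x j) <> Num.sg (delta X x 1))
    (hdet :
       (det2 (Xtilde X x 1) (Xtilde X x 2) *
          det2 (Xtilde X x 2) (Xtilde X x 3) < 0 /\
        0 < det2 (Xtilde X x 3) (Xtilde X x 4) *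
          det2 (Xtilde X x 4) (Xtilde X x 1))
       \/
       (0 < det2 (Xtilde X x 2) (Xtilde X x 3) *
          det2 (Xtilde X x 3) (Xtilde X x 4) /\
        0 < det2 (Xtilde X x 4) (Xtilde X x 1) *
          det2 (Xtilde X x 1) (Xtilde X x 2))) :
  unique_sliding_vector_field X x.
Proof.
(* The exceptional index of the concave projection must be 1: otherwise a third index [j] would
   share the sign of [delta X x 1], against [hdelta1]. *)
have [d10 dj] : delta X x 1 != 0 /\
    forall j, j != 1 -> Num.sg (delta X x j) = - Num.sg (delta X x 1).
  case: hconcave => i [di hi]; case: (i =P 1) => [<-//|/eqP i1].
  have [j /andP[j1 ji]] : exists j : 'Z_4, (j != 1) && (j != i).
    case: (i =P 2) => [->|/eqP i2]; first by exists 3.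
    by exists 2; rewrite (eq_sym _ i).
  by have := hdelta1 j j1; rewrite (hi j ji) (hi 1) // eq_sym.
have Z4E : [/\ 1 + 1 = 2 :> 'Z_4, 2 + 1 = 3 :> 'Z_4, 3 + 1 = 4 :> 'Z_4 &
    4 + 1 = 1 :> 'Z_4] by split; apply: val_inj.
have [e1 e2 e3 e4] := Z4E.
have D1 := delta_orient X x 1; have D2 := delta_orient X x 2.
have D3 := delta_orient X x 3; have D4 := delta_orient X x 4.
rewrite ?(e1, e2, e3, e4) in D1 D2 D3 D4.
have sj j : j != 1 ->
    (delta X x 1 < 0 -> 0 < delta X x j) /\
    (0 < delta X x 1 -> delta X x j < 0).
  move=> /dj sgj; split=> d1.
    by rewrite -sgr_gt0 sgj oppr_gt0 sgr_lt0.
  by rewrite -sgr_lt0 sgj oppr_lt0 sgr_gt0.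
have [s2p s2n] := sj 2 isT; have [s3p s3n] := sj 3 isT.
have [s4p s4n] := sj 4 isT.
rewrite !det2_Xtilde in hdet.
set p1 := Xpoint X x 1 in D1 D2 D3 D4 hdet.
set p2 := Xpoint X x 2 in D1 D2 D3 D4 hdet.
set p3 := Xpoint X x 3 in D1 D2 D3 D4 hdet.
set p4 := Xpoint X x 4 in D1 D2 D3 D4 hdet.
have : exists! z, interior_zero p1 p2 p3 p4 z.
  rewrite D1 D2 D3 D4 in d10 s2p s2n s3p s3n s4p s4n.
  case: (ltrgt0P (orient p1 p2 p3)) d10 => // d1 _.
    (* For positive [delta X x 1], a reflection reverses all orientations but keeps the products of
       two cross products in [hdet]. *)
    apply: (@exists_unique_transfer _ _ (interior_zero (reflect_pt p1)
      (reflect_pt p2) (reflect_pt p3) (reflect_pt p4)) _ id id) => // [z|z|].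
    - by move/interior_zero_reflect.
    - by move/interior_zero_reflect.
    by apply: unique_interior_zero_dart;
      rewrite ?orient_reflect ?cross_reflect ?mulrNN ?oppr_gt0 ?oppr_lt0;
      auto.
  by apply: unique_interior_zero_dart; auto.
case=> -[s t] [z0 zu].
have back (u : R) : (1 + (2 * u - 1)) / 2 = u by field.
exists ((2 * s - 1, 2 * t - 1), sliding_vector X x (2 * s - 1) (2 * t - 1)).
split=> [|[[psi phi] v] /= [/sliding_zeroP /zu [-> ->] ->]].
  by split=> //=; apply/sliding_zeroP; rewrite !back.
have forth (u : R) : 2 * ((1 + u) / 2) - 1 = u by field.
by rewrite !forth.
Qed.
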